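(* Let $k\ge2$ and consider a collection of transformations in $\mathrm{PGL}_k(\mathbb{C})$, each with $\mathrm{PGL}_k(\mathbb{R})$-compatible non-repeated eigenvalues. Suppose there exist a flag pair $A,C$ in $\mathbb{C}^k$ and a nonzero vector $d\in\mathbb{C}^k$ such that, for every eigendirection $v$ of a transformation in the collection, $A,\langle v\rangle,C,\langle d\rangle$ are in generic position. Then the collection is simultaneously conjugate into $\mathrm{PGL}_k(\mathbb{R})$ if (a) for each hyperbolic eigendirection $h$ of a transformation in the collection, $[A,\langle h\rangle,C,\langle d\rangle]\in\mathbb{R}$ for each of the $k-1$ projections; and (b) for each elliptic eigendirection pair $v_1,v_2$ of a transformation in the collection, $[A,\langle v_1\rangle,C,\langle d\rangle]=\overline{[A,\langle v_2\rangle,C,\langle d\rangle]}$ for each of the $k-1$ projections.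
   Context: $\mathrm{PGL}_k(\mathbb{R})$ is regarded as the image of $\mathrm{GL}_k(\mathbb{R})$ in $\mathrm{PGL}_k(\mathbb{C})$. A collection $\{M_j\}$ is simultaneously conjugate into $\mathrm{PGL}_k(\mathbb{R})$ if a single $\Gamma\in\mathrm{PGL}_k(\mathbb{C})$ satisfies $\Gamma^{-1}M_j\Gamma\in\mathrm{PGL}_k(\mathbb{R})$ for all $j$. The eigenvalues of (a representative of) $M$ are $\mathrm{PGL}_k(\mathbb{R})$-compatible if there is a real line $\ell$ through $0$ in $\mathbb{C}$ such that every eigenvalue lies in $\ell$ or is swapped with another eigenvalue by reflection about $\ell$. Eigenvalues in $\ell$ (and their eigendirections) are hyperbolic; those swapped in pairs by the reflection are elliptic, and the two corresponding eigendirections form an elliptic eigendirection pair. A flag $F$ in $\mathbb{C}^k$ is $0\subsetneq F_1\subsetneq\dots\subsetneq F_k=\mathbb{C}^k$ with $\dim F_j=j$. A flag pair $A,C$ consists of the flags of an ordered basis $u_1,\dots,u_k$ and of its reverse: $A_j=\langle u_1,\dots,u_j\rangle$, $C_j=\langle u_k,\dots,u_{k-j+1}\rangle$. Flags or partial flags $A,B,\dots,Z$ are in generic position if $A_{i_A}\oplus\cdots\oplus Z_{i_Z}=\mathbb{C}^k$ whenever the nonnegative indices sum to $k$; for a line such as $\langle v\rangle$ only the indices $0$ and $1$ occur. In $\mathbb{C}P^1=\mathbb{C}\cup\{\infty\}$, $[a,b,c,d]=\frac{(a-d)(c-b)}{(a-b)(c-d)}$. The $k-1$ projections of $[A,\langle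 v\rangle,C,\langle d\rangle]$ are, for $i+j=k-2$, $i,j\ge0$, the cross ratios of the four lines in the two-dimensional space $\mathbb{C}^k/(A_i\oplus C_j)$ given by the images of $A_{i+1}\oplus C_j$, $\langle v\rangle\oplus A_i\oplus C_j$, $A_i\oplus C_{j+1}$, $\langle d\rangle\oplus A_i\oplus C_j$ in this order. Equalities compare projections with the same indices. *)

(* Defs.v *)
(* The reals are an arbitrary [realType] R, and the complex numbers are R[i]. *)
From HB Require Import structures.
From mathcomp Require Export all_boot all_order all_algebra.
From mathcomp Require Export generic_quotient ring.
From mathcomp Require Export boolp classical_sets reals.
From mathcomp Require Export complex.

Set Implicit Arguments.
Unset Strict Implicit.
Unset Printing Implicit Defensive.

Export Order.TTheory GRing.Theory Num.Theory.

Local Open Scope ring_scope.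
Local Open Scope complex_scope.
Local Open Scope quotient_scope.

Section GeneralLinear.
Variables (F : fieldType) (k : nat).

Record GL := MkGL { GLval :> 'M[F]_k; GL_unit : GLval \in unitmx }.

HB.instance Definition _ := [isSub for GLval].
HB.instance Definition _ := [Choice of GL by <:].

Definition GL_mul (A B : GL) : GL.
Proof. by exists (A *m B); rewrite unitmx_mul !GL_unit. Defined.

Definition GL_one : GL := MkGL (unitmx1 F k).

Definition GL_inv (A : GL) : GL.
Proof. by exists (invmx A); rewrite unitmx_inv GL_unit. Defined.

Lemma GL_mulA : associative GL_mul.
Proof. by move=> A B C; apply: val_inj; rewrite /= mulmxA. Qed.
Lemma GL_mul1 : left_id GL_one GL_mul.
Proof. by move=> A; apply: val_inj; rewrite /= mul1mx. Qed.
Lemma GL_1mul : right_id GL_one GL_mul.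
Proof. by move=> A; apply: val_inj; rewrite /= mulmx1. Qed.
Lemma GL_mulV : left_inverse GL_one GL_inv GL_mul.
Proof. by move=> A; apply: val_inj; rewrite /= mulVmx ?GL_unit. Qed.
Lemma GL_Vmul : right_inverse GL_one GL_inv GL_mul.
Proof. by move=> A; apply: val_inj; rewrite /= mulmxV ?GL_unit. Qed.

HB.instance Definition _ :=
  isGroup.Build GL GL_mulA GL_mul1 GL_1mul GL_mulV GL_Vmul.

Definition scalar_equiv (A B : GL) : bool :=
  `[< exists2 c : F, c != 0 & (A : 'M_k) = c *: (B : 'M_k) >].

Lemma scalar_equiv_refl : reflexive scalar_equiv.
Proof. by move=> A; apply/asboolP; exists 1; rewrite ?oner_neq0 ?scale1r. Qed.
Lemma scalar_equiv_trans : transitive scalar_equiv.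
Proof.
move=> B A C /asboolP[c c0 E] /asboolP[c' c'0 E']; apply/asboolP.
by exists (c * c'); rewrite ?mulf_neq0 // E E' scalerA.
Qed.
Lemma scalar_equiv_sym : symmetric scalar_equiv.
Proof.
suff imp A B : scalar_equiv A B -> scalar_equiv B A.
  by move=> A B; apply/idP/idP; apply: imp.
move=> /asboolP[c c0 E]; apply/asboolP; exists c^-1; first by rewrite invr_eq0.
by rewrite E scalerA mulVf ?scale1r.
Qed.

Canonical scalar_equiv_rel :=
  EquivRel scalar_equiv scalar_equiv_refl scalar_equiv_sym scalar_equiv_trans.

Definition PGL := {eq_quot scalar_equiv}.
HB.instance Definition _ := Choice.on PGL.
HB.instance Definition _ := EqQuotient.on PGL.

Lemma PGLP (A B : GL) :
  \pi_PGL A = \pi_PGL B <->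
  exists2 c : F, c != 0 & (A : 'M_k) = c *: (B : 'M_k).
Proof.
split=> [/eqmodP/asboolP //|AB].
by apply/eqmodP; apply/asboolP.
Qed.

Definition PGL_mul : PGL -> PGL -> PGL := lift_op2 PGL GL_mul.
Definition PGL_inv : PGL -> PGL := lift_op1 PGL GL_inv.

Lemma pi_PGL_mul : {morph \pi : A B / GL_mul A B >-> PGL_mul A B}.
Proof.
move=> A B; unlock PGL_mul; apply/PGLP => /=.
have /esym/PGLP[a a0 ->] := reprK (\pi_PGL A).
have /esym/PGLP[b b0 ->] := reprK (\pi_PGL B).
by exists (a * b); rewrite ?mulf_neq0 // -scalemxAl -scalemxAr scalerA.
Qed.
Canonical pi_PGL_mul_morph := PiMorph2 pi_PGL_mul.

Lemma pi_PGL_inv : {morph \pi : A / GL_inv A >-> PGL_inv A}.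
Proof.
move=> A; unlock PGL_inv; apply/PGLP => /=.
have /esym/PGLP[a a0 ->] := reprK (\pi_PGL A).
by exists a^-1; rewrite ?invr_eq0 ?invmxZ // unitmxZ ?unitfE ?GL_unit.
Qed.
Canonical pi_PGL_inv_morph := PiMorph1 pi_PGL_inv.

Definition PGL_one : PGL := \pi GL_one.

Lemma PGL_mulA : associative PGL_mul.
Proof. by do 3!elim/quotW => ?; rewrite !piE GL_mulA. Qed.
Lemma PGL_mul1 : left_id PGL_one PGL_mul.
Proof. by elim/quotW => ?; rewrite /PGL_one !piE GL_mul1. Qed.
Lemma PGL_1mul : right_id PGL_one PGL_mul.
Proof. by elim/quotW => ?; rewrite /PGL_one !piE GL_1mul. Qed.
Lemma PGL_mulV : left_inverse PGL_one PGL_inv PGL_mul.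
Proof. by elim/quotW => ?; rewrite /PGL_one !piE GL_mulV. Qed.
Lemma PGL_Vmul : right_inverse PGL_one PGL_inv PGL_mul.
Proof. by elim/quotW => ?; rewrite /PGL_one !piE GL_Vmul. Qed.

HB.instance Definition _ :=
  isGroup.Build PGL PGL_mulA PGL_mul1 PGL_1mul PGL_mulV PGL_Vmul.

End GeneralLinear.

Section RealForm.
Variables (R : realType) (k : nat).

Definition GL_complexify (A : GL R k) : GL R[i] k.
Proof.
exists (map_mx (real_complex R) A).
by rewrite map_unitmx GL_unit.
Defined.

Definition PGL_real : set (PGL R[i] k) :=
  range (fun A : GL R k => \pi_(PGL R[i] k) (GL_complexify A)).

Definition conjugate_into_PGL_real (I : Type) (M : I -> PGL R[i] k) : Prop :=
  exists Gamma : PGL R[i] k,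
    forall j, PGL_real (Gamma^-1 * M j * Gamma)%g.

End RealForm.

(* A real line through 0 in C is given by a nonzero direction w. *)
Section Eigen.
Variables (R : realType) (k : nat).
Implicit Types (A : 'M[R[i]]_k) (v : 'cV[R[i]]_k) (w z a : R[i]).

Definition on_line w z : Prop := exists t : R, z = t%:C * w.

(* For |w| = 1 this is w^2 * conj z, the reflection about the real line Rw. *)
Definition reflection w z : R[i] := w / conjc w * conjc z.

(* [eigenvalue] is phrased with row vectors in the library; the eigenvalues are
   the same, but eigenvectors below are column vectors. *)
Definition PGL_real_compatible_along A w : Prop :=
  w != 0 /\
  forall a, eigenvalue A a ->
    on_line w a \/
    exists b, [/\ eigenvalue A b, b != a & reflection w a = b].

Definition non_repeated_eigenvalues A : Prop :=
  forall a, eigenvalue A a -> mup a (char_poly A) = 1%N.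

Definition eigenvector A a v : Prop := v != 0 /\ A *m v = a *: v.

Definition eigendirection A v : Prop := exists a, eigenvector A a v.

Definition hyperbolic_eigendirection A w v : Prop :=
  exists2 a, on_line w a & eigenvector A a v.

Definition elliptic_eigendirection_pair A w v1 v2 : Prop :=
  exists a1 a2, [/\ a1 != a2, reflection w a1 = a2,
                    eigenvector A a1 v1 & eigenvector A a2 v2].

End Eigen.

Section Flags.
Variables (F : fieldType) (k : nat).
Local Notation V := 'cV[F]_k.

(* Only the subspaces of index at most k are meaningful. *)
Record flag := MkFlag {
  flag_space :> nat -> {vspace V};
  flag_dim : forall j, (j <= k)%N -> \dim (flag_space j) = j;
  flag_sub : forall i j, (i <= j <= k)%N ->
    (flag_space i <= flag_space j)%VS }.

Definition flag_pair (A C : flag) : Prop :=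
  exists2 u : k.-tuple V, basis_of fullv u &
    forall j, (j <= k)%N ->
      A j = <<take j u>>%VS /\ C j = <<take j (rev u)>>%VS.

(* The partial flag 0 < <v>, with its two indices 0 and 1 as booleans. *)
Definition line_flag (v : V) (b : bool) : {vspace V} :=
  if b then <[v]>%VS else 0%VS.

(* The sum condition already forces i, j <= k. *)
Definition generic_position (A : flag) (v : V) (C : flag) (d : V) : Prop :=
  forall (i j : nat) (a b : bool), (i + a + j + b = k)%N ->
    directv (A i + line_flag v a + C j + line_flag d b)%VS /\
    (A i + line_flag v a + C j + line_flag d b)%VS = fullv.

(* Coordinates F^k / W ~ F^2 on the quotient by a subspace W of codimension 2:
   some linear map to F^2 with kernel W (hence surjective).  Cross ratios do
   not depend on its choice. *)
Definition quotient_coord (W : {vspace V}) : 'Hom(V, 'cV[F]_2) :=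
  xget 0 [set phi : 'Hom(V, 'cV[F]_2) | lker phi = W].

Definition det2 (x y : 'cV[F]_2) : F :=
  x ord0 ord0 * y ord_max ord0 - x ord_max ord0 * y ord0 ord0.

(* (a-d)(c-b) / ((a-b)(c-d)) in homogeneous coordinates, the line spanned by
   (x, y) being the point x/y of F u {oo}; see [cross_ratio_affine]
   and the four lemmas after it. *)
Definition cross_ratio_vec (a b c d : 'cV[F]_2) : F :=
  (det2 a d * det2 c b) / (det2 a b * det2 c d).

Definition cross_ratio (La Lb Lc Ld : {vspace 'cV[F]_2}) : F :=
  cross_ratio_vec (vpick La) (vpick Lb) (vpick Lc) (vpick Ld).

Definition projection (A : flag) (v : V) (C : flag) (d : V) (i j : nat) : F :=
  let W := (A i + C j)%VS in
  let q := quotient_coord W in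
  cross_ratio (q @: (A i.+1 + C j)) (q @: (<[v]> + W))
              (q @: (A i + C j.+1)) (q @: (<[d]> + W)).

Lemma quotient_coordP (W : {vspace V}) :
  (\dim W + 2 = k)%N ->
  lker (quotient_coord W) = W /\ limg (quotient_coord W) = fullv.
Proof.
move=> dimW; have dimV : \dim (fullv : {vspace V}) = k.
  by rewrite dimvf /dim /= muln1.
have dimWC : \dim W^C = 2.
  rewrite dimv_compl dimV; apply/eqP.
  by rewrite -(eqn_add2l (\dim W)) subnKC ?dimW // -[leqRHS]dimW leq_addr.
have capWC : (W^C :&: W = 0)%VS by rewrite capvC capv_compl.
have addWC x : x = daddv_pi W^C W x + daddv_pi W W^C x.
  by rewrite daddv_pi_add // addvC addv_complf memvf.
pose X := tcast dimWC (vbasis W^C).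
have XE : (X : seq V) = vbasis W^C by rewrite val_tcast.
have basX : basis_of W^C X by rewrite XE vbasisP.
have phi_lin : linear
    (fun x : V => \col_(i < 2) coord X i (daddv_pi W^C W x) : 'cV[F]_2).
  by move=> a x y; apply/colP => i; rewrite !mxE !linearP.
pose phiL := GRing.isLinear.Build _ _ _ _ _ phi_lin.
pose phi : {linear V -> 'cV[F]_2} := HB.pack (fun x : V => _ : 'cV_2) phiL.
have ker_phi : lker (linfun phi) = W.
  apply/vspaceP => x; rewrite memv_ker lfunE /=; apply/eqP/idP => [/colP phi0|Wx].
    rewrite (addWC x) (coord_basis basX (memv_pi W^C W x)) big1 ?add0r ?memv_pi //.
    by move=> i _; have := phi0 i; rewrite !mxE => ->; rewrite scale0r.
  apply/colP => i; rewrite !mxE; have := addWC x.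
  rewrite [daddv_pi W W^C x]daddv_pi_id ?capv_compl // => /eqP.
  by rewrite -subr_eq subrr => /eqP <-; rewrite linear0.
have kerE : lker (quotient_coord W) = W.
  exact: (@xgetPex _ 0 [set phi : 'Hom(V, 'cV[F]_2) | lker phi = W]
                   (ex_intro _ _ ker_phi)).
split=> //; apply/eqP; rewrite eqEdim subvf dimvf /dim /= muln1.
have := limg_ker_dim (quotient_coord W) fullv.
by rewrite capfv kerE dimV -[RHS]dimW => /addnI ->.
Qed.

Lemma det2Z (a b : F) (x y : 'cV[F]_2) :
  det2 (a *: x) (b *: y) = (a * b) * det2 x y.
Proof. by rewrite /det2 !mxE; ring. Qed.

Lemma cross_ratio_line (a b c d : 'cV[F]_2) :
  a != 0 -> b != 0 -> c != 0 -> d != 0 ->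
  cross_ratio <[a]> <[b]> <[c]> <[d]> = cross_ratio_vec a b c d.
Proof.
have pickP (x : 'cV[F]_2) : x != 0 -> exists2 t, t != 0 & vpick <[x]> = t *: x.
  move=> x0; have /vlineP[t tE] := memv_pick <[x]>%VS; exists t => //.
  apply: contraNneq x0 => t0; move: (vpick0 <[x]>%VS).
  by rewrite tE t0 scale0r eqxx -dimv_eq0 dim_vline eqb0 negbK.
move=> /pickP[ta ta0 Ea] /pickP[tb tb0 Eb] /pickP[tc tc0 Ec] /pickP[td td0 Ed].
rewrite /cross_ratio /cross_ratio_vec Ea Eb Ec Ed !det2Z.
set p := det2 a d; set q := det2 c b; set r := det2 a b; set s := det2 c d.
have -> : ta * td * p * (tc * tb * q) = ta * tb * tc * td * (p * q) by ring.
have -> : ta * tb * r * (tc * td * s) = ta * tb * tc * td * (r * s) by ring.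
by rewrite -mulf_div divff ?mul1r ?mulf_neq0.
Qed.

Definition aff (z : F) : 'cV[F]_2 := \col_i (if i == ord0 then z else 1).
Definition infty : 'cV[F]_2 := delta_mx ord0 ord0.

Lemma cross_ratio_affine (a b c d : F) :
  cross_ratio_vec (aff a) (aff b) (aff c) (aff d) =
  ((a - d) * (c - b)) / ((a - b) * (c - d)).
Proof. by rewrite /cross_ratio_vec /det2 !mxE /= !mulr1 !mul1r. Qed.

Lemma cross_ratio_infty1 (b c d : F) :
  cross_ratio_vec infty (aff b) (aff c) (aff d) = (c - b) / (c - d).
Proof.
by rewrite /cross_ratio_vec /det2 !mxE /= !mul0r !mulr1 !mul1r !subr0 !mul1r.
Qed.

Lemma cross_ratio_infty2 (a c d : F) :
  cross_ratio_vec (aff a) infty (aff c) (aff d) = (a - d) / (c - d).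
Proof.
rewrite /cross_ratio_vec /det2 !mxE /= !mulr0 !mulr1 !mul1r !sub0r.
by rewrite mulrN1 mulN1r invrN mulrNN.
Qed.

Lemma cross_ratio_infty3 (a b d : F) :
  cross_ratio_vec (aff a) (aff b) infty (aff d) = (a - d) / (a - b).
Proof.
by rewrite /cross_ratio_vec /det2 !mxE /= !mul0r !mulr1 !mul1r !subr0 !mulr1.
Qed.

Lemma cross_ratio_infty4 (a b c : F) :
  cross_ratio_vec (aff a) (aff b) (aff c) infty = (c - b) / (a - b).
Proof.
rewrite /cross_ratio_vec /det2 !mxE /= !mulr0 !mulr1 !mul1r !sub0r.
by rewrite mulN1r mulrN1 invrN mulrNN.
Qed.

End Flags.

(* Main.v *)
(* Let u be the basis of the flag pair and d_l, v_l coordinates in u.  The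
   projection of [A, <v>, C, <d>] at (i, j) is the ratio of consecutive entries
   w_i / w_(i+1) of w_l = v_l / d_l, the coordinates of v in the basis (d_l u_l).
   So in that basis the hypotheses say that w is, up to a scalar, the conjugate
   of the vector w' of the eigendirection for the reflected eigenvalue (v itself
   in the hyperbolic case).  Hence each transformation, divided by the direction
   of its real line, agrees with its entrywise conjugate on a basis of
   eigenvectors, i.e. is a real matrix. *)
Require Import Defs.
From mathcomp Require Import zify.

Set Implicit Arguments.
Unset Strict Implicit.
Unset Printing Implicit Defensive.

Local Open Scope ring_scope.
Local Open Scope quotient_scope.

(** * Column eigenvectors and their span *)

Lemma char_poly_tr (F : fieldType) (n : nat) (A : 'M[F]_n) :
  char_poly A^T = char_poly A.
Proof.
by rewrite /char_poly /char_poly_mx -map_trmx -det_tr linearB /= tr_scalar_mx trmxK.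
Qed.

Lemma eigenvalue_tr (F : fieldType) (n : nat) (A : 'M[F]_n) (a : F) :
  eigenvalue A^T a = eigenvalue A a.
Proof. by rewrite !eigenvalue_root_char char_poly_tr. Qed.

Lemma eigenvectorP (R : realType) (k : nat) (A : 'M[R[i]]_k) (a : R[i]) :
  reflect (exists v, eigenvector A a v) (eigenvalue A a).
Proof.
rewrite -eigenvalue_tr; apply: (iffP eigenvalueP) => [[v vA v0]|[v [v0 Av]]].
  exists v^T; split; first by rewrite trmx_eq0.
  by apply: trmx_inj; rewrite trmx_mul trmxK vA linearZ /= trmxK.
by exists v^T; rewrite ?trmx_eq0 // -trmx_mul Av linearZ.
Qed.

Lemma exists_eigenvalue (R : realType) (k : nat) (A : 'M[R[i]]_k) :
  (0 < k)%N -> exists a, eigenvalue A a.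
Proof.
move=> k0; have /closed_rootP[a Aa] : size (char_poly A) != 1.
  by rewrite size_char_poly eqSS -lt0n.
by exists a; rewrite eigenvalue_root_char.
Qed.

(** Simple roots make [A^T] diagonalizable, so the eigenvectors of [A] span the space. Transposition
    converts between the row eigenspaces of the library and column eigenvectors. *)
Lemma mulmx_eigenvectors_eq0 (R : realType) (k m : nat)
    (A : 'M[R[i]]_k) (X : 'M[R[i]]_(m, k)) :
  non_repeated_eigenvalues A ->
  (forall a v, eigenvector A a v -> X *m v = 0) -> X = 0.
Proof.
case: k A X => [|k] A X simpleA XA; first by apply: thinmx0.
have [rs charE] := closed_field_poly_normal (char_poly A^T).
rewrite (monicP (char_poly_monic _)) scale1r in charE.
have uniq_rs : uniq rs.
  apply: count_mem_uniq => a; rewrite -mu_prod_XsubC -charE char_poly_tr.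
  have [ars|ars] := boolP (a \in rs).
    by apply: simpleA; rewrite -eigenvalue_tr eigenvalue_root_char charE root_prod_XsubC.
  by apply: mupNroot; rewrite -char_poly_tr charE root_prod_XsubC.
(* The minimal polynomial divides the characteristic one, a product of distinct linear factors. *)
have /diagonalizablePeigen[ss _ ssE] : exists2 P : 'M_k.+1, P \in unitmx & similar_diag P A^T.
  by apply/diagonalizableP; exists rs; rewrite // -charE mxminpoly_dvd_char.
apply: trmx_inj; rewrite trmx0 -[LHS]mul1mx; apply/sub_kermxP.
rewrite -ssE (big_nth 0) big_mkord; apply/sumsmx_subP => i _.
apply/rV_subP => v /eigenspaceP vA; apply/sub_kermxP.
have [->|v0] := eqVneq v 0; first by rewrite mul0mx.
apply: trmx_inj; rewrite trmx_mul trmxK trmx0; apply: (XA ss`_i); split.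
  by rewrite trmx_eq0.
by apply: trmx_inj; rewrite trmx_mul trmxK vA linearZ /= trmxK.
Qed.

(** * Projections in the coordinates of a flag pair *)

Section FlagBasis.
Variables (F : fieldType) (k : nat) (u : k.-tuple 'cV[F]_k).
Hypothesis basis_u : basis_of fullv u.

Lemma coord_basisE (v : 'cV[F]_k) : v = \sum_l coord u l v *: u`_l.
Proof. exact: coord_basis basis_u (memvf v). Qed.

Lemma coord_nth (l m : 'I_k) : coord u l u`_m = (m == l)%:R.
Proof. exact: coord_free (basis_free basis_u). Qed.

Lemma mem_take_basis (l : 'I_k) (i : nat) : (l < i)%N -> u`_l \in take i u.
Proof.
move=> li; rewrite -(nth_take 0 li) mem_nth // size_take_min size_tuple.
by rewrite leq_min li ltn_ord.
Qed.

Lemma mem_take_rev_basis (l : 'I_k) (j : nat) :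
  (k - j <= l)%N -> u`_l \in take j (rev u).
Proof.
move=> jl; rewrite take_rev mem_rev size_tuple -(subnKC jl) -nth_drop mem_nth //.
by rewrite size_drop size_tuple ltn_sub2r // (leq_ltn_trans jl).
Qed.

Lemma coord_span_take (l : 'I_k) (i : nat) (v : 'cV[F]_k) :
  (i <= l)%N -> v \in <<take i u>>%VS -> coord u l v = 0.
Proof.
move=> il; suff /subvP sub : (<<take i u>> <= lker (linfun (coord u l : _ -> F^o)))%VS.
  by move=> /sub; rewrite memv_ker lfunE => /eqP.
apply/span_subvP => _ /(nthP 0)[m + <-]; rewrite size_take_min size_tuple leq_min.
case/andP => mi mk; rewrite nth_take // memv_ker lfunE /=.
rewrite (coord_nth l (Ordinal mk)) -val_eqE /= ltn_eqF //.
exact: leq_trans il.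
Qed.

Lemma coord_span_take_rev (l : 'I_k) (j : nat) (v : 'cV[F]_k) :
  (l + j < k)%N -> v \in <<take j (rev u)>>%VS -> coord u l v = 0.
Proof.
move=> lj; suff /subvP sub :
    (<<take j (rev u)>> <= lker (linfun (coord u l : _ -> F^o)))%VS.
  by move=> /sub; rewrite memv_ker lfunE => /eqP.
apply/span_subvP => x; rewrite take_rev mem_rev size_tuple => /(nthP 0)[m].
rewrite size_drop size_tuple => mj <-; rewrite nth_drop memv_ker lfunE /=.
have mk : (k - j + m < k)%N by lia.
by rewrite (coord_nth l (Ordinal mk)) -val_eqE /= gtn_eqF //; lia.
Qed.

Variables (A C : flag F k).
Hypothesis flagsE : forall j, (j <= k)%N ->
  A j = <<take j u>>%VS /\ C j = <<take j (rev u)>>%VS.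

(** With indices from 0, [A l] is spanned by the basis vectors before [u_l] and [C (k - l.+1)] by
    those after it. If coordinate [l] of [x] vanished, it would vanish on the sum of these two
    spaces and the line of [x], which is the whole space. *)
Lemma generic_coord_neq0 (v d : 'cV[F]_k) (l : 'I_k) :
  generic_position A v C d -> coord u l v != 0 /\ coord u l d != 0.
Proof.
move=> gen.
have nonzero (x : 'cV[F]_k) :
    (A l + <[x]> + C (k - l.+1)%N = fullv)%VS -> coord u l x != 0.
  move=> full; apply/eqP => x0.
  have : u`_l \in (A l + <[x]> + C (k - l.+1)%N)%VS by rewrite full memvf.
  case/memv_addP => _ /memv_addP[a aA [_ /vlineP[t ->] ->]] [c cC].
  move/(congr1 (coord u l)); rewrite !linearD linearZ /= coord_nth eqxx x0 mulr0.
  rewrite (@coord_span_take l l a) ?(@coord_span_take_rev l (k - l.+1) c) ?addr0 //.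
  - by move/eqP; rewrite oner_eq0.
  - by have := ltn_ord l; lia.
  - by have [_ <-] := flagsE (leq_subr l.+1 k).
  - by have [<-] := flagsE (ltnW (ltn_ord l)).
have lk := ltn_ord l; split; apply: nonzero.
  have [|_] := gen l (k - l.+1)%N true false; first by rewrite /=; lia.
  by rewrite addv0.
have [|_] := gen l (k - l.+1)%N false true; first by rewrite /=; lia.
by rewrite addv0 -addvA [X in (_ + X)%VS]addvC addvA.
Qed.

Lemma flag1S (i : 'I_k) : A i.+1 = (A i + <[u`_i]>)%VS.
Proof.
have ik := ltn_ord i; have [-> _] := flagsE ik; have [-> _] := flagsE (ltnW ik).
by rewrite (take_nth 0) ?size_tuple // -cats1 span_cat span_seq1.
Qed.

(** [C (k - i)] is spanned by [u_i, ..., u_(k-1)], hence the index shift when [u_i] is split off. *)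
Lemma flag2S (i : 'I_k) : C (k - i)%N = (C (k - i.+1)%N + <[u`_i]>)%VS.
Proof.
have ik := ltn_ord i.
have [_ ->] := flagsE (leq_subr i k); have [_ ->] := flagsE (leq_subr i.+1 k).
rewrite -(subnSK ik) (take_nth 0) ?size_rev ?size_tuple -?cats1; last lia.
rewrite span_cat span_seq1 nth_rev size_tuple; last lia.
by congr (_ + <[u`_ _]>)%VS; lia.
Qed.

(** Modulo [A i + C j] only [u_l] and [u_m] survive. Their images [a], [c] form a basis of the
    plane, and the four determinants of the cross ratio are coordinates of [v] and [d] up to sign
    and the common factor [det2 a c]. *)
Lemma projectionE (v d : 'cV[F]_k) (l m : 'I_k) (i j : nat) :
  (i + j = k - 2)%N -> l = i :> nat -> m = i.+1 :> nat ->
  generic_position A v C d ->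
  projection A v C d i j =
  (coord u l v / coord u l d) / (coord u m v / coord u m d).
Proof.
move=> ijk li mi gen; have mk := ltn_ord m.
have [vl0 dl0] := generic_coord_neq0 l gen.
have [vm0 dm0] := generic_coord_neq0 m gen.
have jE : j = (k - m.+1)%N by lia.
have jSE : j.+1 = (k - m)%N by lia.
rewrite /projection; set W := (A i + C j)%VS; set q := quotient_coord W.
(* Subadditivity bounds the dimension above; below, generic position says that [W] and two lines
   fill the space. *)
have dimW : (\dim W + 2 = k)%N.
  have le_dimW : (\dim W <= i + j)%N.
    rewrite (leq_trans (dimv_add_leqif _ _)) // !flag_dim //; lia.
  suff : (k <= \dim W + 1 + 1)%N by lia.
  have [|_ full] := gen i j true true; first by rewrite /=; lia.
  have kE : k = \dim (W + <[v]> + <[d]>).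
    rewrite /W -[(A i + _ + _)%VS]addvA [(C j + _)%VS]addvC addvA full.
    by rewrite dimvf /dim /= muln1.
  rewrite {1}kE (leq_trans (dimv_add_leqif _ _)) // leq_add ?dim_vline ?leq_b1 //.
  by rewrite (leq_trans (dimv_add_leqif _ _)) // leq_add ?dim_vline ?leq_b1.
have [kerq imq] := quotient_coordP dimW; rewrite -/q in kerq imq.
(* Otherwise rewriting would unfold the choice operator in [quotient_coord]. *)
clearbody q.
have qW x : x \in W -> q x = 0 by rewrite -kerq memv_ker => /eqP.
have qDW x : (q @: (<[x]> + W) = <[q x]>)%VS.
  rewrite limgD limg_line; apply/addv_idPl/subvP => y /memv_imgP[z /qW -> ->].
  exact: mem0v.
set a := q u`_l; set c := q u`_m.
(* Basis vectors of index below [i] lie in [A i], those of index above [i.+1] in [C j]; [q] kills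
   both. *)
have qE x : q x = coord u l x *: a + coord u m x *: c.
  have lm : m != l by rewrite -val_eqE /= li mi gtn_eqF.
  rewrite {1}[x]coord_basisE linear_sum (bigD1 l) //= (bigD1 m) //= !linearZ.
  rewrite big1 ?addr0 // => h /andP[hl hm]; apply/qW/memvZ.
  rewrite -!val_eqE /= li mi in hl hm; rewrite /W.
  have [hi|ih] := ltnP h i.
    rewrite (subvP (addvSl _ _)) //; have [|-> _] := @flagsE i; first lia.
    exact/memv_span/mem_take_basis.
  rewrite (subvP (addvSr _ _)) //; have [|_ ->] := @flagsE j; first lia.
  by apply/memv_span/mem_take_rev_basis; lia.
have qa : q u`_l = a by []; have qc : q u`_m = c by [].
clearbody a c.
have det_a x : det2 a (q x) = coord u m x * det2 a c.
  by rewrite qE /det2 !mxE; ring.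
have det_c x : det2 c (q x) = - coord u l x * det2 a c.
  by rewrite qE /det2 !mxE; ring.
(* Otherwise all determinants of vectors in the image of [q] vanish, yet [q] reaches the standard
   basis. *)
have det_ac : det2 a c != 0.
  have im_q y : exists x, y = q x.
    by have /memv_imgP[x _ ->] : y \in limg q; [rewrite imq memvf | exists x].
  apply/eqP => ac0; have [x xE] := im_q (delta_mx ord0 ord0).
  have [y yE] := im_q (delta_mx ord_max ord0).
  have : det2 (q x) (q y) = (coord u l x * coord u m y - coord u m x * coord u l y) * det2 a c.
    by rewrite !qE /det2 !mxE; ring.
  rewrite ac0 mulr0 -xE -yE /det2 !mxE /= mulr1 mulr0 subr0 => /eqP.
  by rewrite oner_eq0.
have det2_neq0 (x y : 'cV[F]_2) : det2 x y != 0 -> x != 0 /\ y != 0.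
  by move=> xy; split; apply: contraNneq xy => ->; rewrite /det2 !mxE ?mulr0 ?mul0r subrr.
have [a0 c0] := det2_neq0 _ _ det_ac.
have qv0 : q v != 0.
  by have [] := det2_neq0 a (q v); rewrite // det_a mulf_neq0.
have qd0 : q d != 0.
  by have [] := det2_neq0 a (q d); rewrite // det_a mulf_neq0.
have -> : (A i.+1 + C j = <[u`_l]> + W)%VS.
  by rewrite -li flag1S li -addvA [X in (_ + X)%VS]addvC addvA addvC.
have -> : (A i + C j.+1 = <[u`_m]> + W)%VS.
  by rewrite jSE flag2S -jE addvA addvC.
rewrite !qDW qa qc cross_ratio_line // /cross_ratio_vec !det_a !det_c.
by field; apply/and5P; split; rewrite ?oppr_eq0.
Qed.

End FlagBasis.

(** * Conjugate vectors and real matrices *)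

Lemma conj_proportional (R : realType) (k : nat) (w w' : 'cV[R[i]]_k) :
  (forall l, w l ord0 != 0) -> (forall l, w' l ord0 != 0) ->
  (forall l m : 'I_k, m = l.+1 :> nat ->
    w l ord0 / w m ord0 = conjc (w' l ord0 / w' m ord0)) ->
  exists c, w = c *: map_mx (@conjc R) w'.
Proof.
case: k w w' => [|k] w w' w0 w'0 ww'; first by exists 0; apply/colP => -[].
(* Entry 0 forces the scalar; the consecutive ratios carry the equality from each entry to the
   next. *)
exists (w ord0 ord0 / conjc (w' ord0 ord0)); apply/colP => -[l lk]; rewrite !mxE.
have conj_neq0 h : conjc (w' h ord0) != 0 by rewrite conjc_eq0.
elim: l lk => [|l IHl] lk.
  by rewrite (_ : Ordinal lk = ord0) ?divfK //; apply: val_inj.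
pose h := Ordinal (ltnW lk); set m := Ordinal lk.
have := ww' h m erefl; rewrite rmorphM /= conjc_inv => /eqP.
rewrite eqr_div // (IHl (ltnW lk)) => /eqP whm.
by apply: (mulfI (conj_neq0 h)); rewrite -whm mulrCA mulrA.
Qed.

Lemma map_Re_conj (R : realType) (m n : nat) (N : 'M[R[i]]_(m, n)) :
  map_mx (@conjc R) N = N -> N = map_mx (real_complex R) (map_mx (@complex.Re R) N).
Proof.
move=> /matrixP NN; apply/matrixP => i j; have := NN i j; rewrite !mxE.
case: (N i j) => x y [/eqP]; rewrite eq_sym -addr_eq0 -mulr2n mulrn_eq0 /= => /eqP ->.
by [].
Qed.

(** * The projective frame given by the basis and [d] *)

Section Frame.
Variables (F : fieldType) (k : nat) (u : k.-tuple 'cV[F]_k).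
Hypothesis basis_u : basis_of fullv u.
Variable d : 'cV[F]_k.
Hypothesis d_neq0 : forall l, coord u l d != 0.

(** The columns are rescaled so that [d] is their sum, which makes [d] the unit point of the
    frame. *)
Definition frame_mx : 'M[F]_k := \matrix_(i, l) (coord u l d * u`_l i ord0).
Definition frame_coord (v : 'cV[F]_k) : 'cV[F]_k :=
  \col_l (coord u l v / coord u l d).

Lemma mul_frame_coord v : frame_mx *m frame_coord v = v.
Proof.
rewrite [RHS](coord_basisE basis_u); apply/colP => i; rewrite summxE !mxE.
by apply: eq_bigr => l _; rewrite !mxE mulrC mulrA divfK.
Qed.

(** The frame coordinates of the standard basis vectors form an explicit right inverse. *)
Lemma frame_unitmx : frame_mx \in unitmx.
Proof.
suff /mulmx1_unit[] :
    frame_mx *m \matrix_(l, i) frame_coord (delta_mx i ord0) l ord0 = 1%:M by [].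
apply/matrixP => i j; have /colP/(_ i) := mul_frame_coord (delta_mx j ord0).
rewrite !mxE eqxx andbT => <-.
by apply: eq_bigr => l _; rewrite !mxE.
Qed.

Lemma frame_coordE v : frame_coord v = invmx frame_mx *m v.
Proof. by rewrite -[in RHS](mul_frame_coord v) mulKmx ?frame_unitmx. Qed.

End Frame.

(** * Reality of the transformations in the frame *)

Theorem theorem9 (R : realType) (k : nat) (hk : (2 <= k)%N)
    (I : Type) (M : I -> PGL R[i] k)
    (rep : I -> GL R[i] k) (hrep : forall m, \pi_(PGL R[i] k) (rep m) = M m)
    (ell : I -> R[i])
    (hcompat : forall m, PGL_real_compatible_along (rep m) (ell m))
    (hsimple : forall m, non_repeated_eigenvalues (rep m))
    (A C : flag R[i] k) (hAC : flag_pair A C)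
    (d : 'cV[R[i]]_k) (hd : d != 0)
    (hgen : forall m v, eigendirection (rep m) v -> generic_position A v C d)
    (ha : forall m h, hyperbolic_eigendirection (rep m) (ell m) h ->
      forall i j : nat, (i + j = k - 2)%N ->
        projection A h C d i j \is Num.real)
    (hb : forall m v1 v2, elliptic_eigendirection_pair (rep m) (ell m) v1 v2 ->
      forall i j : nat, (i + j = k - 2)%N ->
        projection A v1 C d i j = conjc (projection A v2 C d i j)) :
  conjugate_into_PGL_real M.
Proof.
(* Generic position constrains [d] only through an eigendirection, so some transformation is needed
   to see that the coordinates of [d] are nonzero; an empty collection is conjugated by the
   identity. *)
have [[m0]|noI] := pselect (inhabited I); last first.
  by exists 1%g => m; case: noI; exists.
have [u basis_u flagsE] := hAC.
have coord_neq0 m a v l : eigenvector (rep m) a v -> coord u l v != 0 /\ coord u l d != 0.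
  move=> av; apply: (generic_coord_neq0 basis_u flagsE).
  by apply: (hgen m); exists a.
have d_neq0 l : coord u l d != 0.
  have [|a /eigenvectorP[v av]] := exists_eigenvalue (rep m0); first exact: ltnW.
  by have [] := coord_neq0 m0 a v l av.
have unitG := frame_unitmx basis_u d_neq0.
set G := frame_mx u d in unitG.
have GE v : frame_coord u d v = invmx G *m v by apply: frame_coordE.
exists (\pi_(PGL R[i] k) (MkGL unitG)) => m.
have [ell0 compat] := hcompat m.
(* This unifies the two cases: a hyperbolic eigenvector is its own partner, since the reflection
   fixes its eigenvalue and its projections are real. *)
have partner a v : eigenvector (rep m) a v -> exists b v',
    [/\ eigenvector (rep m) b v', reflection (ell m) a = b &
        forall i j, (i + j = k - 2)%N ->
          projection A v C d i j = conjc (projection A v' C d i j)].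
  move=> av; have /compat[a_on|[b [/eigenvectorP[v' bv'] ba ab]]] : eigenvalue (rep m) a.
  - by apply/eigenvectorP; exists v.
  - exists a, v; split=> // [|i j ij].
      have [t ->] := a_on; rewrite /reflection rmorphM [X in _ * (X * _)]conjc_real.
      by field; rewrite conjc_eq0.
    have /complex_realP[t ->] : projection A v C d i j \is Num.real.
      by apply: (ha m) ij; exists a.
    by rewrite conjc_real.
  exists b, v'; split=> // i j; apply: (hb m); exists a, b; split=> //.
  by rewrite eq_sym.
have frame_conj a v b v' : eigenvector (rep m) a v -> eigenvector (rep m) b v' ->
    (forall i j, (i + j = k - 2)%N ->
       projection A v C d i j = conjc (projection A v' C d i j)) ->
    exists c, invmx G *m v = c *: map_mx (@conjc R) (invmx G *m v').
  move=> av bv' vv'; rewrite -!GE; apply: conj_proportional => [l|l|l l' ll'].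
  - by rewrite mxE mulf_neq0 ?invr_eq0 //; have [] := coord_neq0 m a v l av.
  - by rewrite mxE mulf_neq0 ?invr_eq0 //; have [] := coord_neq0 m b v' l bv'.
  (* The truncated subtraction is exact, since [l' = l + 1 < k] gives [l <= k - 2]. *)
  have ijk : (l + (k - 2 - l) = k - 2)%N by have := ltn_ord l'; lia.
  have := vv' _ _ ijk.
  rewrite !(projectionE basis_u flagsE (l := l) (m := l')) ?mxE //.
    by apply: (hgen m); exists b.
  by apply: (hgen m); exists a.
(* Dividing by [ell m] turns the line into the real axis, and the reflection of eigenvalues into
   complex conjugation. *)
pose N := (ell m)^-1 *: (invmx G *m rep m *m G).
have NE a v : eigenvector (rep m) a v ->
    N *m (invmx G *m v) = (a / ell m) *: (invmx G *m v).
  move=> [_ av]; rewrite -scalemxAl -!mulmxA mulKVmx // av -scalemxAr.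
  by rewrite scalerA mulrC.
have N_real : map_mx (@conjc R) N = N.
  apply/esym/eqP; rewrite -subr_eq0; apply/eqP.
  (* The factor [invmx G] makes [X] act on eigenvectors of [rep m] themselves instead of on their
     frame coordinates. *)
  rewrite -[LHS](mulmxKV unitG); set X := _ *m invmx G.
  suff -> : X = 0 by rewrite mul0mx.
  apply: (mulmx_eigenvectors_eq0 (hsimple m)) => a v av.
  have [b [v' [bv' ab vv']]] := partner a v av.
  have [c cE] := frame_conj a v b v' av bv' vv'.
  have abE : conjc (b / ell m) = a / ell m.
    rewrite -ab /reflection !rmorphM /= !conjc_inv !conjcK.
    by field; rewrite ell0 conjc_eq0.
  have -> : X *m v = N *m (invmx G *m v) - map_mx (@conjc R) N *m (invmx G *m v).
    by rewrite -mulmxBl mulmxA.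
  (* The conjugate of [N] acts on the conjugate of the partner vector by the conjugate of
     [b / ell m], which is [a / ell m]: the same scalar by which [N] acts on the vector of [v]. *)
  rewrite [in X in _ - X]cE -scalemxAr -map_mxM (NE b v' bv') map_mxZ /= abE.
  by rewrite scalerA mulrC -scalerA -cE (NE a v av) subrr.
have unitN : N \in unitmx.
  by rewrite unitmxZ ?unitfE ?invr_eq0 // !unitmx_mul unitmx_inv unitG GL_unit.
have NRe := map_Re_conj N_real.
have unitRe : map_mx (@complex.Re R) N \in unitmx.
  by rewrite -(map_unitmx (real_complex R)) -NRe.
exists (MkGL unitRe) => //; rewrite -hrep.
have -> : ((\pi_(PGL R[i] k) (MkGL unitG))^-1 * \pi_(PGL R[i] k) (rep m) *
           \pi_(PGL R[i] k) (MkGL unitG))%g =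
  \pi_(PGL R[i] k) (GL_mul (GL_mul (GL_inv (MkGL unitG)) (rep m)) (MkGL unitG)).
  by rewrite !pi_PGL_mul pi_PGL_inv.
(* The normalizing scalar in [N] is invisible in the projective group. *)
apply/PGLP; exists (ell m)^-1; first by rewrite invr_eq0.
by rewrite /= -NRe.
Qed.
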